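(* Binary free-connex conjunctive queries and $\mathsf{FO}^{\wedge}_2$ queries are equally expressive: every binary free-connex CQ is equivalent to an $\mathsf{FO}^{\wedge}_2$ query, and every $\mathsf{FO}^{\wedge}_2$ query is equivalent to a binary free-connex CQ (equivalent meaning the same output on every database over every commutative semiring).
   Context: Fix a commutative semiring $(K,\oplus,\odot,\mathbb{0},\mathbb{1})$ with $\mathbb{0}\neq\mathbb{1}$. Databases map relation symbols to $K$-relations (functions $(\mathbb{N}_{>0})^a\to K$ with finite support) and constant symbols to positive integers. Formulas are built from relational atoms $R(\bar x)$ and comparison atoms $x\le c$ ($c$ a constant symbol) by $\exists$, $\wedge$ (and $\vee$ for $\mathsf{FO}^+$), evaluated with semiring semantics ($\wedge\mapsto\odot$, $\exists\mapsto\bigoplus$, $x\le c\mapsto\mathbb{1}$ iff $\nu(x)\le c^{db}$ else $\mathbb{0}$). A query is $H(\bar x)\leftarrow\varphi$ with $\bar x$ a sequence of free variables of $\varphi$ (possibly repeated) containing all of them; it outputs $H(\bar d)=$ value of $\varphi$ on $\bar x\mapsto\bar d$ if $\bar d$ respects the repetitions, else $\mathbb{0}$. A query is binary if all relational atoms (body and head) have arity at most two. $\mathsf{FO}^{\wedge}$ is the disjunction-free fragment; $\mathsf{FO}^{\wedge}_2$ consists of the $\mathsf{FO}^{\wedge}$ formulas using at most two distinct variables overall (free or bound, variables may be re-quantified); an $\mathsf{FO}^{\wedge}_2$ query is a binary query whose body is in $\mathsf{FO}^{\wedge}_2$. A conjunctive query (CQ) is $H(\bar x)\leftarrow\exists\bar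 y.a_1\wedge\dots\wedge a_n$ with $a_i$ relational or comparison atoms. It is acyclic if there is an undirected tree whose nodes are the atoms $a_1,\dots,a_n$ (comparison atoms treated as unary atoms) such that for each variable $z$ the atoms mentioning $z$ induce a connected subtree. It is free-connex if it is acyclic and the query obtained by adding the head atom $H(\bar x)$ to the body is also acyclic. *)

(* Defs.v *)
From HB Require Import structures.
From mathcomp Require Import all_boot all_order all_algebra finmap.
From mathcomp Require Import boolp classical_sets fsbigop.

Set Implicit Arguments.
Unset Strict Implicit.
Unset Printing Implicit Defensive.

Import GRing.Theory.

Definition pnat := {n : nat | 0 < n}.

Definition pnat1 : pnat := exist (fun n : nat => 0 < n) 1 isT.

Definition var := nat.

Record vocab := Vocab {
  rsym : Type;
  csym : Type;
  arity : rsym -> nat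
}.

Record database (S : vocab) (K : comNzSemiRingType) := Database {
  db_rel : forall R : rsym S, {fsfun (arity R).-tuple pnat -> K with 0%R};
  db_const : csym S -> pnat
}.

Inductive atom (S : vocab) :=
| Rel (R : rsym S) of (arity R).-tuple var
| Le of var & csym S.

Inductive formula (S : vocab) :=
| Atom of atom S
| Ex of var & formula S
| And of formula S & formula S
| Or of formula S & formula S.

Section Syntax.
Variable S : vocab.
Implicit Types (a : atom S) (f g : formula S).

Definition atom_vars a : seq var :=
  match a with Rel _ xs => tval xs | Le x _ => [:: x] end.

Definition atom_binary a : bool :=
  match a with Rel R _ => arity R <= 2 | Le _ _ => true end.

Fixpoint free f : seq var :=
  match f with
  | Atom a => atom_vars a
  | Ex y f => [seq x <- free f | x != y]
  | And f g | Or f g => free f ++ free g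
  end.

Fixpoint all_vars f : seq var :=
  match f with
  | Atom a => atom_vars a
  | Ex y f => y :: all_vars f
  | And f g | Or f g => all_vars f ++ all_vars g
  end.

Fixpoint formula_binary f : bool :=
  match f with
  | Atom a => atom_binary a
  | Ex _ f => formula_binary f
  | And f g | Or f g => formula_binary f && formula_binary g
  end.

Fixpoint disjunction_free f : bool :=
  match f with
  | Atom _ => true
  | Ex _ f => disjunction_free f
  | And f g => disjunction_free f && disjunction_free g
  | Or _ _ => false
  end.

(* Safe formulas have finite support in their free variables. Dropping the
   condition on [Ex] would allow a vacuous quantifier, whose value would be an
   infinite sum of a constant, which has no meaning in a semiring. *)
Fixpoint safe f : Prop :=
  match f with
  | Atom _ => True
  | Ex y f => y \in free f /\ safe f
  | And f g => safe f /\ safe g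
  | Or f g => [/\ free f =i free g, safe f & safe g]
  end.

Definition FO_conj2 f : Prop :=
  disjunction_free f /\ size (undup (all_vars f)) <= 2.

End Syntax.

Section Semantics.
Variables (S : vocab) (K : comNzSemiRingType) (db : database S K).
Local Open Scope ring_scope.

Definition upd (nu : var -> pnat) (y : var) (d : pnat) : var -> pnat :=
  fun x => if x == y then d else nu x.

Definition eval_atom (a : atom S) (nu : var -> pnat) : K :=
  match a with
  | Rel R xs => db_rel db R (map_tuple nu xs)
  | Le x c => if (val (nu x) <= val (db_const db c))%N then 1 else 0
  end.

Fixpoint eval (f : formula S) (nu : var -> pnat) : K :=
  match f with
  | Atom a => eval_atom a nu
  | Ex y f => \sum_(d \in [set: pnat]%classic) eval f (upd nu y d)
  | And f g => eval f nu * eval g nu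
  | Or f g => eval f nu + eval g nu
  end.

End Semantics.

(* The head relation symbol matters only through its arity [n], so only the
   variable sequence of the head atom is recorded. *)
Record query (S : vocab) (n : nat) := Query {
  q_head : n.-tuple var;
  q_body : formula S
}.

Definition query_wf (S : vocab) (n : nat) (q : query S n) : Prop :=
  safe (q_body q) /\ q_head q =i free (q_body q).

Definition query_binary (S : vocab) (n : nat) (q : query S n) : Prop :=
  n <= 2 /\ formula_binary (q_body q).

Definition FO_conj2_query (S : vocab) (n : nat) (q : query S n) : Prop :=
  [/\ query_wf q, query_binary q & FO_conj2 (q_body q)].

Definition respects (n : nat) (xs : n.-tuple var) (d : n.-tuple pnat) : bool :=
  [forall i, forall j, (tnth xs i == tnth xs j) ==> (tnth d i == tnth d j)].

(* The valuation xs |-> d; variables outside [xs] get the irrelevant value 1. *)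
Definition head_val (n : nat) (xs : n.-tuple var) (d : n.-tuple pnat) :
    var -> pnat :=
  fun x => nth pnat1 d (index x xs).

Definition output (S : vocab) (n : nat) (q : query S n)
    (K : comNzSemiRingType) (db : database S K) (d : n.-tuple pnat) : K :=
  if respects (q_head q) d then eval db (q_body q) (head_val (q_head q) d)
  else 0%R.

Definition equivalent (S : vocab) (n : nat) (q1 q2 : query S n) : Prop :=
  forall (K : comNzSemiRingType) (db : database S K) (d : n.-tuple pnat),
    output q1 db d = output q2 db d.

(* The nonempty list of body atoms is [cq_atom1 :: cq_atoms]. *)
Record cq (S : vocab) (n : nat) := CQ {
  cq_head : n.-tuple var;
  cq_ex : seq var;
  cq_atom1 : atom S;
  cq_atoms : seq (atom S)
}.

Definition cq_query (S : vocab) (n : nat) (q : cq S n) : query S n :=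
  Query (cq_head q)
    (foldr (@Ex S)
       (foldl (fun f a => And f (Atom a)) (Atom (cq_atom1 q)) (cq_atoms q))
       (cq_ex q)).

Definition is_tree (T : finType) (e : rel T) : Prop :=
  [/\ symmetric e, irreflexive e, forall i j : T, connect e i j &
      forall p : seq T, 2 < size p -> ~ ucycle e p].

(* Nodes of the tree are atom occurrences, each given by its variables. *)
Definition acyclic (vs : seq (seq var)) : Prop :=
  exists e : rel 'I_(size vs), is_tree e /\
    forall (z : var) (i j : 'I_(size vs)),
      let mentions k := z \in nth [::] vs k in
      mentions i -> mentions j ->
      connect [rel u v : 'I_(size vs) | [&& e u v, mentions u & mentions v]] i j.

Definition cq_atom_vars (S : vocab) (n : nat) (q : cq S n) : seq (seq var) :=
  [seq atom_vars a | a <- cq_atom1 q :: cq_atoms q].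

Definition cq_acyclic (S : vocab) (n : nat) (q : cq S n) : Prop :=
  acyclic (cq_atom_vars q).

Definition free_connex (S : vocab) (n : nat) (q : cq S n) : Prop :=
  cq_acyclic q /\ acyclic (tval (cq_head q) :: cq_atom_vars q).

Definition binary_free_connex_cq (S : vocab) (n : nat) (q : cq S n) : Prop :=
  [/\ query_wf (cq_query q), query_binary (cq_query q) & free_connex q].

(* Main.v *)
(** Since atoms have at most two variables, acyclicity says that the Gaifman
    graph of the query is a forest.

    From a free-connex CQ, root a join tree of the body plus the head at the
    head and eliminate leaves: the variables of a leaf not shared with its
    parent occur nowhere else, so they can be quantified right at the leaf. What
    remains has its free variables in the parent, hence can be rewritten over
    the two variables of the parent and conjoined to it.

    From a two-variable formula over [x], [y], rename the bound variables apart
    and pull the quantifiers out. Give a fresh copy of [y] the parent [x] (and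
    vice versa); then every atom, and the head, lies on an edge [{z, par z}] of
    a forest, and such families have a join tree.

    Safe formulas vanish outside a finite domain, so both equivalences reduce
    to distributivity and reordering of finite sums. *)
From mathcomp Require Import all_boot all_order all_algebra finmap.
From mathcomp Require Import boolp classical_sets fsbigop.
From mathcomp Require Import zify.
Require Import Defs.

Set Implicit Arguments.
Unset Strict Implicit.
Unset Printing Implicit Defensive.

Import GRing.Theory.

(** * Join trees *)

(** The value [pa r] is ignored, so the root may be given any parent. *)
Definition parent_rel (T : finType) (pa : T -> T) (r i j : T) : bool :=
  (i != r) && (pa i == j) || (j != r) && (pa j == i).
Arguments parent_rel {T} pa r i j /.

Lemma parent_rel_sym (T : finType) (pa : T -> T) (r : T) :
  symmetric (parent_rel pa r).
Proof. by move=> i j; rewrite /= orbC. Qed.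

(** Climbing decreases the rank, so it ends at [r], which gives connectedness. On a cycle, both
    neighbours of a node of maximal rank would have to be its parent, hence coincide. *)
Lemma parent_rel_tree (T : finType) (rk : T -> nat) (pa : T -> T) (r : T) :
  (forall i, i != r -> rk (pa i) < rk i) -> is_tree (parent_rel pa r).
Proof.
move=> rk_pa; have sym := @parent_rel_sym T pa r; split=> //.
- move=> i /=; rewrite orbb; apply/negP => /andP[/rk_pa + /eqP pai].
  by rewrite pai ltnn.
- have to_r i : connect (parent_rel pa r) i r.
    have [k] := ubnP (rk i); elim: k => // k IH in i *; rewrite ltnS => ik.
    have [->|ir] := eqVneq i r; first exact: connect0.
    apply: connect_trans (IH (pa i) (leq_trans (rk_pa i ir) ik)).
    by apply: connect1; rewrite /= ir eqxx.
  move=> i j; apply: connect_trans (to_r i) _.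
  by rewrite (sym_connect_sym sym).
- move=> p p2 cyc.
  have /hasP[x0 x0p _] : has predT p by rewrite has_predT; apply: leq_trans p2.
  have [x xp xmax] : exists2 x, x \in p & forall y, y \in p -> rk y <= rk x.
    by case: (arg_maxnP rk x0p) => x xp xmax; exists x.
  have up y : y \in p -> parent_rel pa r x y -> pa x = y.
    move=> yp /= /orP[/andP[_ /eqP//]|/andP[/rk_pa + /eqP payx]].
    by rewrite payx ltnNge xmax.
  case/rot_to: xp => i q rotp.
  have memq y : (y \in x :: q) = (y \in p) by rewrite -rotp mem_rot.
  have sizeq : size (x :: q) = size p by rewrite -rotp size_rot.
  have : ucycle (parent_rel pa r) (x :: q) by rewrite -rotp rot_ucycle.
  case/lastP: q => [|q b] in rotp memq sizeq *.
    by move: p2; rewrite -sizeq.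
  case: q => [|a q] in rotp memq sizeq *.
    by move: p2; rewrite -sizeq.
  case/andP=> /=; rewrite rcons_path last_rcons => /and3P[xa _ bx].
  rewrite mem_rcons inE negb_or => /and3P[_ /andP[+ _] _].
  have <- : pa x = a by apply: up => //; rewrite -memq !inE eqxx orbT.
  have <- : pa x = b; last by rewrite eqxx.
  apply: up; first by rewrite -memq !(inE, mem_rcons) eqxx !orbT.
  by rewrite parent_rel_sym.
Qed.

(* The nodes mentioning [z] form a subtree because climbing to parents only
   stops at the node of least rank among them. *)
Lemma acyclic_of_rank (vs : seq (seq var)) (rk : 'I_(size vs) -> nat) :
  0 < size vs -> injective rk ->
  (forall i, (exists j, rk j < rk i) -> exists2 p, rk p < rk i &
     forall z j, rk j < rk i -> z \in nth [::] vs i -> z \in nth [::] vs j ->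
       z \in nth [::] vs p) ->
  acyclic vs.
Proof.
move=> vs_gt0 rk_inj step.
(* The root is the node of least rank, the only one without an earlier node. *)
pose r := [arg min_(i < Ordinal vs_gt0) rk i].
have r_min i : rk r <= rk i by rewrite /r; case: arg_minnP => // j _; apply.
have /choice[pa paP] : forall i, exists p, i != r ->
    rk p < rk i /\ forall z j, rk j < rk i -> z \in nth [::] vs i ->
      z \in nth [::] vs j -> z \in nth [::] vs p.
  move=> i; have [->|ir] := eqVneq i r; first by exists r.
  have [|p pi pP] := step i; last by exists p.
  by exists r; rewrite ltn_neqAle r_min (inj_eq rk_inj) eq_sym ir.
exists (parent_rel pa r); split.
  by apply: (@parent_rel_tree _ rk) => i /paP[].
move=> z i j m mi mj.
case: (@arg_minnP _ i m rk mi) => k mk kmin.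
set e' := [rel u v | _].
have e'sym : symmetric e'.
  by move=> u v /=; rewrite orbC [m u && _]andbC.
have to_k (l : 'I_(size vs)) : m l -> connect e' l k.
  have [b] := ubnP (rk l); elim: b => // b IH in l *; rewrite ltnS => lb ml.
  have [->|lk] := eqVneq l k; first exact: connect0.
  have kl : rk k < rk l by rewrite ltn_neqAle kmin // (inj_eq rk_inj) eq_sym lk.
  have lr : l != r.
    by apply: contraTneq kl => ->; rewrite -leqNgt.
  have [pal /(_ z k kl ml mk) mpa] := paP l lr.
  apply: connect_trans (IH (pa l) (leq_trans pal lb) mpa).
  by apply: connect1; rewrite /= lr eqxx /= ml.
apply: connect_trans (to_k i mi) _.
by rewrite (sym_connect_sym e'sym); apply: to_k.
Qed.

(* Atoms are ranked by their largest variable [t], pairs [{t, par t}] coming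
   before singletons [{t}]; ties are broken by the index. *)
Lemma forest_acyclic (vs : seq (seq var)) (par : var -> var) :
  0 < size vs -> (forall z, par z <= z) ->
  (forall v, v \in vs -> exists z, {subset v <= [:: z; par z]}) -> acyclic vs.
Proof.
move=> vs_gt0 par_le forest; pose m := size vs.
pose top (v : seq var) := \max_(z <- v) z.
pose key (v : seq var) := (top v).*2 + (par (top v) \notin v).
have top_ge v z : z \in v -> z <= top v by move=> zv; apply: leq_bigmax_seq.
have top_in v z : z \in v -> top v \in v.
  elim: v z => // a [|b v] IH z _; first by rewrite /top big_seq1 mem_head.
  rewrite /top big_cons inE /maxn; case: ifP => _; last by rewrite eqxx.
  by rewrite (IH b) ?orbT // mem_head.
(* The [z] given by [forest] need not occur in [v], but the largest variable of [v] can take its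
   place because [par] never increases. *)
have shape v : v \in vs -> {subset v <= [:: top v; par (top v)]}.
  move=> /forest[z sub] y yv; have := sub _ yv; have := sub _ (top_in _ _ yv).
  have := top_ge _ _ yv; have := par_le z; rewrite !inE.
  move=> pz yt /orP[]/eqP tE /orP[]/eqP yE; subst y; rewrite ?tE ?eqxx ?orbT //.
  by rewrite -tE eqn_leq yt tE pz.
pose v (i : 'I_m) := nth [::] vs i.
have vP i : v i \in vs by apply: mem_nth.
(* Lexicographic in the key and the index; the index is below [m], which makes [rk] injective. *)
pose rk (i : 'I_m) := key (v i) * m + i.
have rk_key i j : rk j < rk i -> key (v j) <= key (v i).
  apply: contraTT; rewrite -ltnNge -leqNgt /rk => lt'.
  apply: leq_trans (leq_addr _ _).
  apply: leq_trans (leq_mul lt' (leqnn m)).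
  by rewrite mulSn addnC leq_add2r ltnW.
apply: (@acyclic_of_rank vs rk) => //.
  move=> i j /(congr1 (fun k => k %% m)); rewrite !modnMDl !modn_small //.
  exact: val_inj.
move=> i [j0 j0i].
(* An earlier atom containing the top variable of [v i] has the same top, and it contains the parent
   of that top if [v i] does, since pairs come first. So it contains all of [v i]. *)
have [/existsP[j /andP[ji tj]]|/existsPn nojt] :=
    boolP [exists j, (rk j < rk i) && (top (v i) \in v j)].
  exists j => // z k _ zi _; rewrite -/(v j).
  have tt : top (v j) = top (v i).
    apply/eqP; rewrite eqn_leq (top_ge _ _ tj) andbT.
    by have := rk_key _ _ ji; rewrite /key; do 2!case: (_ \notin _); lia.
  have := shape _ (vP i) _ zi; rewrite !inE => /orP[/eqP->//|/eqP zE].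
  have := rk_key _ _ ji; rewrite /key tt -zE zi addn0 zE.
  by case: (boolP (par (top (v i)) \in v j)) => //= _; rewrite addn1 ltnn.
(* Otherwise only the parent of the top variable can be shared with earlier atoms, and any earlier
   atom containing it will do. *)
have at_par z k : rk k < rk i -> z \in v i -> z \in v k -> z = par (top (v i)).
  move=> ki zi zk; have := shape _ (vP i) _ zi.
  rewrite !inE => /orP[/eqP zE|/eqP//].
  by have := nojt k; rewrite ki -zE zk.
have [/existsP[j /andP[ji pj]]|/existsPn nojp] :=
    boolP [exists j, (rk j < rk i) && (par (top (v i)) \in v j)].
  by exists j => // z k ki zi zk; rewrite (at_par z k).
(* Here [v i] shares nothing with earlier atoms, so an arbitrary one serves as parent. *)
exists j0 => // z k ki zi zk; have := nojp k.
by rewrite ki -(at_par z k ki zi zk) [z \in v k]zk.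
Qed.

(** * Running-intersection orders extracted from join trees *)

(** If the two neighbours differed, a simple path between them avoiding [i] would close to a cycle
    through [i]. *)
Lemma tree_neighbour (T : finType) (e : rel T) (i p q : T) :
  is_tree e -> e i p -> e i q ->
  connect [rel u v | [&& e u v, u != i & v != i]] q p -> q = p.
Proof.
case=> sym irr _ acyc ip iq /connectP[r0 r0P pE].
case/shortenP: r0P pE => r rP uniq_r _ pE.
have [|qp] := eqVneq q p; first by [].
have ne z : e i z -> z != i by apply: contraTneq => ->; rewrite irr.
have path_r : path e q r by apply: sub_path rP => u w /= /and3P[].
have i_r : i \notin q :: r.
  rewrite inE negb_or eq_sym ne //=.
  elim: r q {iq qp pE uniq_r path_r} rP => // a r IH q /= /andP[/and3P[_ _ ai] ar].
  by rewrite inE negb_or eq_sym ai (IH a).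
case: (acyc (i :: q :: r)).
  by case: r pE {rP uniq_r path_r i_r} => //= pq; rewrite pq eqxx in qp.
rewrite /ucycle /=; apply/andP; split; last by apply/andP; split.
by rewrite rcons_path iq path_r -pE sym ip.
Qed.

(* Running intersection, listed from the leaves to the root. *)
Fixpoint rip (vs : seq (seq var)) (h : seq var) : Prop :=
  match vs with
  | [::] => True
  | v :: s => (exists2 w, w \in rcons s h &
      forall z u, u \in rcons s h -> z \in v -> z \in u -> z \in w) /\ rip s h
  end.

(** A subtree is grown from the head, one adjacent node at a time; each new node goes to the front
    of the list, so leaves come first. Its neighbour in the subtree acts as its parent. *)
Lemma acyclic_rip (h : seq var) (vs : seq (seq var)) :
  acyclic (h :: vs) -> exists s : seq nat,
    perm_eq s (iota 0 (size vs)) /\ rip [seq nth [::] vs i | i <- s] h.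
Proof.
case=> e [treee subtree]; pose m := size vs.
have [sym irr conn acyc] := treee.
pose r : 'I_m.+1 := ord0.
pose v (i : 'I_m.+1) := nth [::] (h :: vs) i.
pose inside (s : seq 'I_m.+1) := [rel i j : 'I_m.+1 | [&& e i j, i \in s & j \in s]].
suff grow k : k <= m -> exists s : seq 'I_m.+1,
    [/\ size s = k, uniq (rcons s r), rip (map v s) h &
      forall i j, i \in rcons s r -> j \in rcons s r ->
        connect (inside (rcons s r)) i j].
  have [s [sz uniq_s rip_s _]] := grow m (leqnn m).
  have s_pos i : i \in s -> 0 < i.
    move=> is_; rewrite lt0n; apply/eqP => i0.
    move: uniq_s; rewrite rcons_uniq => /andP[/negP[]].
    by rewrite (_ : r = i) //; apply: val_inj.
  (* Node 0 is [h], so a positive node [i] is the entry [i - 1] of [vs]. *)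
  pose f (i : 'I_m.+1) := (nat_of_ord i).-1.
  exists (map f s); split; last first.
    rewrite -map_comp (_ : map _ s = map v s) //.
    by apply/eq_in_map => i /s_pos; rewrite /v /= /f; case: (nat_of_ord i).
  have uniq_t : uniq (map f s).
    rewrite map_inj_in_uniq; first by move: uniq_s; rewrite rcons_uniq => /andP[].
    move=> i j /s_pos i0 /s_pos j0 ij; apply: val_inj => /=.
    by rewrite -(prednK i0) -(prednK j0) -[_.-1]/(f i) ij.
  apply: uniq_perm; rewrite ?iota_uniq //.
  apply: (uniq_min_size uniq_t _ _).2; last by rewrite size_iota size_map sz.
  move=> _ /mapP[i /s_pos i0 ->]; rewrite mem_iota add0n /=.
  by rewrite -ltnS /f prednK // -/m.
elim: k => [_|k IH km]; first by exists [::]; split=> // i j;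
  rewrite !inE => /eqP-> /eqP->; apply: connect0.
have [s [sz uniq_s rip_s conn_s]] := IH (ltnW km).
set S := rcons s r in uniq_s conn_s.
have [i0 i0S] : exists i0, i0 \notin S.
  apply/existsP; rewrite -negb_forall; apply/negP => /forallP allS.
  have := uniq_leq_size (enum_uniq 'I_m.+1) (fun i _ => allS i).
  by rewrite size_enum_ord size_rcons sz ltnS leqNgt km.
(* A path from an outside node to the root has to enter [S] along some edge. *)
have [i [p [iS pS ip]]] : exists i p, [/\ i \notin S, p \in S & e i p].
  have /connectP[q] := conn i0 r.
  have rS : r \in S by rewrite mem_rcons mem_head.
  elim: q => [|a q IHq] /= in i0 i0S *.
    by move=> _ rE; rewrite -rE rS in i0S.
  move=> /andP[i0a aq] lastq; have [aS|aS] := boolP (a \in S).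
    by exists i0, a.
  exact: IHq aS aq lastq.
exists (i :: s); split=> /=; rewrite ?sz //.
- by rewrite iS.
- split=> //; exists (v p).
    by rewrite -[h]/(v r) -map_rcons map_f.
  move=> z u; rewrite -[h]/(v r) -map_rcons => /mapP[j jS ->] zi zj.
  have /connectP[q0 q0P jE] := subtree z i j zi zj.
  case/shortenP: q0P jE => q qP uniq_q _ jE.
  case: q => [|a q] in qP uniq_q jE *.
    by move: jS iS; rewrite jE => ->.
  move: qP uniq_q => /= /andP[/and3P[ia _ za] aq] /andP[iq _].
  (* [a] follows [i] on a path through nodes mentioning [z]. The rest of that path, and then [S],
     lead from [a] to [p] avoiding [i], so both are the same neighbour of [i]. *)
  suff <- : a = p by [].
  apply: (tree_neighbour treee ip ia); apply: (@connect_trans _ _ j).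
    apply/connectP; exists q => //.
    elim: q a iq aq {ia za jE} => //= b q IHq a; rewrite !inE !negb_or.
    move=> /and3P[ai bi iq] /andP[/and3P[-> _ _] bq] /=.
    by rewrite eq_sym ai eq_sym bi IHq // inE negb_or bi.
  apply: connect_sub (conn_s j p jS pS) => x y /= /and3P[exy xS yS].
  apply: connect1; rewrite /= exy /=.
  by apply/andP; split; apply: contraNneq iS => <-.
- have sub x y : connect (inside S) x y -> connect (inside (i :: S)) x y.
    apply: connect_sub => a b /= /and3P[ab aS bS].
    by apply: connect1; rewrite /= ab !inE aS bS !orbT.
  have isym : symmetric (inside (i :: S)).
    by move=> a b /=; rewrite sym [(a \in _) && _]andbC.
  have i_to j : j \in i :: S -> connect (inside (i :: S)) i j.
    rewrite inE => /orP[/eqP->|jS]; first exact: connect0.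
    apply: connect_trans (sub _ _ (conn_s p j pS jS)).
    by apply: connect1; rewrite /= ip !inE eqxx pS orbT.
  move=> a b aS bS; apply: connect_trans (i_to b bS).
  by rewrite (sym_connect_sym isym) i_to.
Qed.

(** * Evaluation over a finite domain *)

Section FiniteDomain.
Variables (S : vocab) (K : comNzSemiRingType) (db : database S K).
Variable D : seq pnat.
Implicit Types (f g : formula S) (a : atom S) (nu : var -> pnat).
Local Open Scope ring_scope.

Fixpoint evalD f nu : K :=
  match f with
  | Atom a => eval_atom db a nu
  | Ex y f => \sum_(d <- D) evalD f (upd nu y d)
  | And f g => evalD f nu * evalD g nu
  | Or f g => evalD f nu + evalD g nu
  end.

Definition atom_supported a : Prop :=
  forall nu z, z \in atom_vars a -> nu z \notin D -> eval_atom db a nu = 0.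

Fixpoint supported f : Prop :=
  match f with
  | Atom a => atom_supported a
  | Ex _ f => supported f
  | And f g | Or f g => supported f /\ supported g
  end.

(** Both claims go by one induction: the sum of a quantifier is cut down to [D] because the
    quantified variable is free in its scope, so the value vanishes when it leaves [D]. A repetition
    in [D] would count a summand twice. *)
Lemma eval_evalD f : uniq D -> safe f -> supported f ->
  (forall nu, eval db f nu = evalD f nu) /\
  (forall nu z, z \in free f -> nu z \notin D -> eval db f nu = 0).
Proof.
move=> uniqD; elim: f => [a|y f IH|f IHf g IHg|f IHf g IHg] /=.
- by move=> _ supp; split.
- move=> [yf /IH{}IH] /IH[fE f0]; split=> [nu|nu z].
    rewrite (fsbigE D) //=.
      by rewrite big_mkcond; apply: eq_bigr => d _; rewrite in_setT fE.
    by move=> d _ dD; apply: f0 yf _; rewrite /upd eqxx.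
  rewrite mem_filter => /andP[zy zf] nuz.
  (* All summands vanish, so the empty list covers the support. *)
  rewrite (fsbigE [::]) //= ?big_nil // => d _ _.
  by apply: f0 zf _; rewrite /upd (negbTE zy).
- move=> [/IHf{}IHf /IHg{}IHg] [/IHf[fE f0] /IHg[gE g0]]; split=> [nu|nu z].
    by rewrite fE gE.
  rewrite mem_cat => /orP[zf|zg] nuz; first by rewrite (f0 _ z) ?mul0r.
  by rewrite (g0 _ z) ?mulr0.
- move=> [fg /IHf{}IHf /IHg{}IHg] [/IHf[fE f0] /IHg[gE g0]]; split=> [nu|nu z].
    by rewrite fE gE.
  rewrite mem_cat fg orbb => zg nuz.
  by rewrite (f0 _ z) ?fg // (g0 _ z) ?addr0.
Qed.

Lemma evalD_free f nu nu' : {in free f, nu =1 nu'} -> evalD f nu = evalD f nu'.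
Proof.
elim: f nu nu' => [[R xs|x c]|y f IH|f IHf g IHg|f IHf g IHg] nu nu' /= eq_nu.
- by congr (db_rel db R _); apply: val_inj => /=; apply/eq_in_map.
- by rewrite eq_nu ?mem_head.
- apply: eq_bigr => d _; apply: IH => z zf; rewrite /upd.
  by have [//|zy] := eqVneq z y; apply: eq_nu; rewrite mem_filter zy.
- congr (_ * _); [apply: IHf|apply: IHg] => z zf;
    by apply: eq_nu; rewrite mem_cat zf ?orbT.
- congr (_ + _); [apply: IHf|apply: IHg] => z zf;
    by apply: eq_nu; rewrite mem_cat zf ?orbT.
Qed.

Definition indep (F : (var -> pnat) -> K) (y : var) : Prop :=
  forall nu d, F (upd nu y d) = F nu.

Lemma evalD_indep f y : y \notin free f -> indep (evalD f) y.
Proof.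
move=> yf nu d; apply: evalD_free => z zf; rewrite /upd.
by case: eqVneq => // zy; rewrite -zy zf in yf.
Qed.

(** The summand is an arbitrary function of valuations, so that products over lists fit without
    being written as formulas. *)
Fixpoint esum (ys : seq var) (F : (var -> pnat) -> K) nu : K :=
  match ys with
  | [::] => F nu
  | y :: ys => \sum_(d <- D) esum ys F (upd nu y d)
  end.

Lemma evalD_foldr_Ex f ys : evalD (foldr (@Ex S) f ys) =1 esum ys (evalD f).
Proof. by elim: ys => //= y ys IH nu; apply: eq_bigr. Qed.

Lemma eq_esum ys F G : F =1 G -> esum ys F =1 esum ys G.
Proof. by move=> FG; elim: ys => //= y ys IH nu; apply: eq_bigr. Qed.

Lemma esum_cat ys zs F : esum (ys ++ zs) F =1 esum ys (esum zs F).
Proof. by elim: ys => //= y ys IH nu; apply: eq_bigr. Qed.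

(** Updates at distinct variables commute, so the outermost sum can be moved innermost. *)
Lemma esum_sum y ys F nu : y \notin ys ->
  \sum_(d <- D) esum ys F (upd nu y d) =
  esum ys (fun nu => \sum_(d <- D) F (upd nu y d)) nu.
Proof.
elim: ys nu => //= z ys IH nu; rewrite inE negb_or => /andP[yz yys].
rewrite exchange_big /=; apply: eq_bigr => d _; rewrite -IH //.
apply: eq_bigr => d' _; congr (esum _ _ _); apply: funext => x; rewrite /upd.
by case: (eqVneq x z) => // ->; rewrite eq_sym (negbTE yz).
Qed.

Lemma esum_filter (p : pred var) ys F : uniq ys ->
  esum ys F =1 esum [seq y <- ys | ~~ p y] (esum [seq y <- ys | p y] F).
Proof.
elim: ys => //= y ys IH /andP[yys uys] nu.
under eq_bigr do rewrite IH //.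
by case: (p y) => //=; rewrite esum_sum // mem_filter negb_and yys orbT.
Qed.

Lemma esumMr ys F G : {in ys, forall y, indep G y} ->
  esum ys (fun nu => F nu * G nu) =1 fun nu => esum ys F nu * G nu.
Proof.
elim: ys => //= y ys IH Gys nu; rewrite mulr_suml; apply: eq_bigr => d _.
rewrite IH => [|z zys]; last by apply: Gys; rewrite inE zys orbT.
by rewrite Gys // mem_head.
Qed.

Lemma esum_indep ys F y : indep F y -> indep (esum ys F) y.
Proof.
move=> Fy; elim: ys => //= z ys IH nu d; apply: eq_bigr => d' _.
have [->|zy] := eqVneq z y.
  congr (esum _ _ _); apply: funext => x; rewrite /upd.
  by case: eqVneq.
rewrite -[RHS](IH _ d); congr (esum _ _ _); apply: funext => x; rewrite /upd.
by case: (eqVneq x z) => // ->; rewrite (negbTE zy).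
Qed.

(** Since [s] is injective and fixes [ys], no other variable is sent into [ys], and updates at [ys]
    commute with composition by [s]. *)
Lemma esum_rename (s : var -> var) ys F nu : injective s ->
  {in ys, forall y, s y = y} ->
  esum ys (fun nu => F (nu \o s)) nu = esum ys F (nu \o s).
Proof.
move=> s_inj; elim: ys nu => //= y ys IH nu s_ys; apply: eq_bigr => d _.
rewrite IH => [|z zys]; last by apply: s_ys; rewrite inE zys orbT.
congr (esum _ _ _); apply: funext => x; rewrite /upd /=.
by rewrite -{1}(s_ys y) ?mem_head // (inj_eq s_inj).
Qed.

End FiniteDomain.

(** * Finite supports and the passage to query equivalence *)

Lemma supported_sub (S : vocab) (K : comNzSemiRingType) (db : database S K)
    (D D' : seq pnat) (f : formula S) :
  {subset D <= D'} -> supported db D f -> supported db D' f.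
Proof.
move=> sub; elim: f => //= [a supp nu z za nuz|f IHf g IHg [] /IHf + /IHg|
  f IHf g IHg [] /IHf + /IHg] //.
by apply: supp za _; apply: contra nuz; apply: sub.
Qed.

(** [D] collects the entries of the tuples in the finite supports and the positive numbers up to the
    constants. *)
Lemma supported_exists (S : vocab) (K : comNzSemiRingType) (db : database S K)
    (f : formula S) : exists2 D, uniq D & supported db D f.
Proof.
suff [D suppD] : exists D, supported db D f.
  exists (undup D); first exact: undup_uniq.
  by apply: supported_sub suppD => d; rewrite mem_undup.
elim: f => [[R xs|x c]|y f [D]|f [D Df] g [D' Dg]|f [D Df] g [D' Dg]] /=.
- exists (flatten [seq tval t | t <- finsupp (db_rel db R)]) => nu z /= zxs.
  apply: contraNeq => supp_xs; apply/flattenP; exists (map nu xs).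
    by apply/mapP; exists (map_tuple nu xs) => //; rewrite mem_finsupp.
  exact: map_f.
(* [insub] discards 0, which is not a positive integer. *)
- exists (pmap insub (iota 0 (val (db_const db c)).+1)) => nu z.
  rewrite inE => /eqP-> nux; rewrite [LHS]/=; case: ifP => // le; case/negP: nux.
  by rewrite mem_pmap_sub mem_iota add0n ltnS le.
- by exists D.
- exists (D ++ D'); split; [move: Df | move: Dg]; apply: supported_sub => d;
    by rewrite mem_cat => ->; rewrite ?orbT.
- exists (D ++ D'); split; [move: Df | move: Dg]; apply: supported_sub => d;
    by rewrite mem_cat => ->; rewrite ?orbT.
Qed.

(** Quantifying over every list [D] makes this a purely algebraic statement about finite sums;
    supports only enter in [evalD_equivalent]. *)
Definition evalD_equiv (S : vocab) (f g : formula S) : Prop :=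
  forall (K : comNzSemiRingType) (db : database S K) (D : seq pnat),
    evalD db D f =1 evalD db D g.

Lemma evalD_equivalent (S : vocab) (n : nat) (h : n.-tuple var)
    (f g : formula S) :
  safe f -> safe g -> evalD_equiv f g -> equivalent (Query h f) (Query h g).
Proof.
move=> sf sg fg K db d; rewrite /output /=; case: ifP => // _.
(* The conjunction provides one domain that supports both formulas. *)
have [D uniqD [Df Dg]] := supported_exists db (And f g).
have [-> _] := eval_evalD uniqD sf Df; have [-> _] := eval_evalD uniqD sg Dg.
exact: fg.
Qed.

(** * Conjunctive queries *)

Section Conjunctions.
Variable S : vocab.
Implicit Types (f : formula S) (a : atom S) (s : seq (atom S)).

(** Same left-nested shape as the body in [cq_query], so the two are convertible. *)
Definition conj_atoms a s : formula S :=
  foldl (fun f a => And f (Atom a)) (Atom a) s.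

Definition atoms_vars s : seq var := flatten [seq atom_vars a | a <- s].

Lemma conj_atoms_rcons a s b :
  conj_atoms a (rcons s b) = And (conj_atoms a s) (Atom b).
Proof. by rewrite /conj_atoms foldl_rcons. Qed.

Lemma free_conj_atoms a s : free (conj_atoms a s) = atoms_vars (a :: s).
Proof.
elim/last_ind: s => [|s b IH]; first by rewrite /atoms_vars /= cats0.
rewrite conj_atoms_rcons /= IH /atoms_vars -rcons_cons map_rcons.
by rewrite flatten_rcons.
Qed.

Lemma safe_conj_atoms a s : safe (conj_atoms a s).
Proof. by elim/last_ind: s => // s b IH; rewrite conj_atoms_rcons. Qed.

Lemma binary_conj_atoms a s :
  formula_binary (conj_atoms a s) = all (@atom_binary S) (a :: s).
Proof.
elim/last_ind: s => [|s b IH]; first by rewrite /= andbT.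
by rewrite conj_atoms_rcons /= IH /= all_rcons -andbA [_ && atom_binary b]andbC.
Qed.

Lemma evalD_conj_atoms (K : comNzSemiRingType) (db : database S K) D a s nu :
  evalD db D (conj_atoms a s) nu = (\prod_(b <- a :: s) eval_atom db b nu)%R.
Proof.
elim/last_ind: s => [|s b IH]; first by rewrite big_seq1.
by rewrite conj_atoms_rcons /= IH -rcons_cons big_rcons.
Qed.

Lemma free_foldr_Ex f ys z :
  (z \in free (foldr (@Ex S) f ys)) = (z \in free f) && (z \notin ys).
Proof.
elim: ys => [|y ys IH] /=; first by rewrite andbT.
by rewrite mem_filter IH inE negb_or andbCA.
Qed.

Lemma safe_foldr_Ex f ys : safe f ->
  safe (foldr (@Ex S) f ys) <-> uniq ys /\ {subset ys <= free f}.
Proof.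
move=> sf; elim: ys => [|y ys IH] /=; first by split.
rewrite free_foldr_Ex; split=> [[/andP[yf yys] /IH[uys sub]]|].
  split; first by rewrite yys.
  by move=> z; rewrite inE => /orP[/eqP->|/sub].
move=> [/andP[yys uys] sub]; split; first by rewrite yys sub ?mem_head.
by apply/IH; split=> // z zys; apply: sub; rewrite inE zys orbT.
Qed.

Lemma binary_foldr_Ex f ys :
  formula_binary (foldr (@Ex S) f ys) = formula_binary f.
Proof. by elim: ys. Qed.

Lemma disjunction_free_foldr_Ex f ys :
  disjunction_free (foldr (@Ex S) f ys) = disjunction_free f.
Proof. by elim: ys. Qed.

Lemma all_vars_foldr_Ex f ys : all_vars (foldr (@Ex S) f ys) = ys ++ all_vars f.
Proof. by elim: ys => //= y ys ->. Qed.

Lemma free_all_vars f : {subset free f <= all_vars f}.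
Proof.
elim: f => /= [a z //|y f IH z|f IHf g IHg z|f IHf g IHg z].
- by rewrite mem_filter inE => /andP[_ /IH->]; rewrite orbT.
- by rewrite !mem_cat => /orP[/IHf->|/IHg->]; rewrite ?orbT.
- by rewrite !mem_cat => /orP[/IHf->|/IHg->]; rewrite ?orbT.
Qed.

End Conjunctions.

(** Lists with fewer than two variables are padded, so two distinct names are always at hand. *)
Lemma two_vars (l : seq var) : size (undup l) <= 2 ->
  exists x y, x != y /\ {subset l <= [:: x; y]}.
Proof.
move=> sz; suff [x [y [xy sub]]] : exists x y : var,
    x != y /\ {subset undup l <= [:: x; y]}.
  by exists x, y; split=> // z zl; apply: sub; rewrite mem_undup.
have := undup_uniq l; move: (undup _) sz => [|x [|y [|//]]] _ /=.
- by exists 0, 1.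
- by exists x, x.+1; split=> [|z]; rewrite ?inE ?neq_ltn ?ltnSn // => ->.
- by rewrite inE andbT => xy; exists x, y; split=> // z.
Qed.

(** * Renaming of variables *)

Section Renaming.
Variable S : vocab.
Implicit Types (f g : formula S) (a : atom S) (s : var -> var).

Definition rename_atom s a : atom S :=
  match a with Rel R xs => Rel (map_tuple s xs) | Le x c => Le (s x) c end.

Fixpoint rename s f : formula S :=
  match f with
  | Atom a => Atom (rename_atom s a)
  | Ex y f => Ex (s y) (rename s f)
  | And f g => And (rename s f) (rename s g)
  | Or f g => Or (rename s f) (rename s g)
  end.

Lemma atom_vars_rename s a : atom_vars (rename_atom s a) = map s (atom_vars a).
Proof. by case: a. Qed.

Lemma atom_binary_rename s a : atom_binary (rename_atom s a) = atom_binary a.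
Proof. by case: a. Qed.

Lemma eval_atom_rename (K : comNzSemiRingType) (db : database S K) s a nu :
  eval_atom db (rename_atom s a) nu = eval_atom db a (nu \o s).
Proof.
case: a => //= R xs; congr (db_rel db R _).
by apply: val_inj; rewrite /= -map_comp.
Qed.

Lemma atoms_vars_rename s (l : seq (atom S)) :
  atoms_vars (map (rename_atom s) l) = map s (atoms_vars l).
Proof.
rewrite /atoms_vars map_flatten -!map_comp; congr flatten.
by apply: eq_map => a; apply: atom_vars_rename.
Qed.

End Renaming.

Definition transp (x y z : var) : var :=
  if z == x then y else if z == y then x else z.

Lemma transpK x y : involutive (transp x y).
Proof.
rewrite /transp => z; have [->|zx] := eqVneq z x; last have [->|zy] := eqVneq z y.
- by rewrite eqxx; case: eqVneq.
- by rewrite eqxx.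
- by rewrite (negbTE zx) (negbTE zy).
Qed.

Lemma transp_inj x y : injective (transp x y).
Proof. exact: inv_inj (transpK x y). Qed.

Lemma transpL x y : transp x y x = y.
Proof. by rewrite /transp eqxx. Qed.

Lemma transpD x y z : z != x -> z != y -> transp x y z = z.
Proof. by rewrite /transp => /negbTE-> /negbTE->. Qed.

(** * Prenexing two-variable formulas *)

Section Prenex.
Variable S : vocab.
Implicit Types (f g : formula S).

(** The forest with the single edge [{x, y}]. The smaller end is the parent because [forest_acyclic]
    wants parents not to exceed their children. *)
Definition pair_parent (x y z : var) : var :=
  if z == maxn x y then minn x y else z.

Lemma pair_parent_le x y z : pair_parent x y z <= z.
Proof. by rewrite /pair_parent; case: eqVneq => // ->; lia. Qed.

Lemma pair_parent_sub x y :
  {subset [:: x; y] <= [:: maxn x y; pair_parent x y (maxn x y)]}.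
Proof.
by move=> z; rewrite /pair_parent eqxx !inE => /orP[]/eqP->; lia.
Qed.

(* The formula [f] over the variables [x], [y] is the conjunction of [l] with
   the fresh variables [ys] quantified. Its Gaifman graph is a forest, in which
   [par z] is the parent of [z] and roots are their own parents. *)
Record prenex_form (x y : var) f (N M : nat) (ys : seq var)
    (l : seq (atom S)) (par : var -> var) : Prop := PrenexForm {
  pf_le : N <= M;
  pf_ys : {in ys, forall z, N <= z < M};
  pf_uniq : uniq ys;
  pf_nonempty : 0 < size l;
  pf_binary : all (@atom_binary S) l;
  pf_bound : {subset ys <= atoms_vars l};
  pf_free : forall z, (z \in free f) = (z \in atoms_vars l) && (z \notin ys);
  pf_par_le : forall z, par z <= z;
  pf_par : forall z, ~~ (N <= z < M) -> par z = pair_parent x y z;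
  pf_forest : forall v, v \in [seq atom_vars a | a <- l] ->
    exists z, {subset v <= [:: z; par z]};
  pf_eval : forall (K : comNzSemiRingType) (db : database S K) D nu,
    evalD db D f nu =
    esum D ys (fun nu => \prod_(a <- l) eval_atom db a nu)%R nu }.

Lemma prenex_atom x y (a : atom S) N :
  atom_binary a -> {subset atom_vars a <= [:: x; y]} ->
  prenex_form x y (Atom a) N N [::] [:: a] (pair_parent x y).
Proof.
move=> bin sub; split=> //=; rewrite ?bin //.
- by move=> z; rewrite /atoms_vars /= cats0 andbT.
- exact: pair_parent_le.
- move=> v; rewrite inE => /eqP->; exists (maxn x y) => z /sub.
  exact: pair_parent_sub.
- by move=> K db D nu; rewrite big_seq1.
Qed.

Lemma indep_prod (K : comNzSemiRingType) (db : database S K)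
    (l : seq (atom S)) y :
  y \notin atoms_vars l -> indep (fun nu => \prod_(a <- l) eval_atom db a nu)%R y.
Proof.
case: l => [|a l]; first by move=> _ nu d; rewrite !big_nil.
(* The domain [[::]] is an arbitrary choice: [conj_atoms] contains no quantifier. *)
rewrite -free_conj_atoms => /(evalD_indep db [::]) ind nu d.
by rewrite -!(evalD_conj_atoms db [::]).
Qed.

(** The fresh names of [f] lie in [[N, M)] and those of [g] in [[M, L)], so no variable quantified
    in one prenex form occurs in the other, and both forests agree on [x] and [y]. *)
Lemma prenex_and x y f g N M L ys zs l k p q : x < N -> y < N ->
  {subset free f <= [:: x; y]} -> {subset free g <= [:: x; y]} ->
  prenex_form x y f N M ys l p -> prenex_form x y g M L zs k q ->
  prenex_form x y (And f g) N L (ys ++ zs) (l ++ k)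
    (fun z => if z < M then p z else q z).
Proof.
move=> xN yN fxy gxy F G.
have [NM ML] := (pf_le F, pf_le G).
have small z : z \in [:: x; y] -> z < N by rewrite !inE => /orP[]/eqP->.
have l_zs z : z \in zs -> z \notin atoms_vars l.
  move=> /(pf_ys G)/andP[Mz _]; apply/negP => zl.
  have [/(pf_ys F)|zys] := boolP (z \in ys); first by lia.
  by have := pf_free F z; rewrite zl zys => /fxy/small; lia.
have k_ys z : z \in ys -> z \notin atoms_vars k.
  move=> /(pf_ys F)/andP[Nz zM]; apply/negP => zk.
  have [/(pf_ys G)|zzs] := boolP (z \in zs); first by lia.
  by have := pf_free G z; rewrite zk zzs => /gxy/small; lia.
have vars_cat z : z \in atoms_vars (l ++ k) = (z \in atoms_vars l) || (z \in atoms_vars k).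
  by rewrite /atoms_vars map_cat flatten_cat mem_cat.
split.
- lia.
- move=> z; rewrite mem_cat => /orP[/(pf_ys F)|/(pf_ys G)]; lia.
- rewrite cat_uniq (pf_uniq F) (pf_uniq G) andbT /=; apply/hasPn => z.
  by move=> /(pf_ys G) zM; apply/negP => /(pf_ys F); lia.
- by rewrite size_cat addn_gt0 (pf_nonempty F).
- by rewrite all_cat (pf_binary F) (pf_binary G).
- move=> z; rewrite mem_cat vars_cat.
  by move=> /orP[/(pf_bound F)->|/(pf_bound G)->]; rewrite ?orbT.
- move=> z /=; rewrite !mem_cat vars_cat (pf_free F) (pf_free G) negb_or.
  have := k_ys z; have := l_zs z.
  case: (z \in ys) => /= [_ /(_ isT)/negbTE->|]; first by rewrite !andbF.
  by case: (z \in zs) => /= [/(_ isT)/negbTE->|_ _]; rewrite ?andbF ?andbT.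
- by move=> z; case: ifP => _; [apply: pf_par_le F z | apply: pf_par_le G z].
- move=> z zNL; case: ifP => zM; first by apply: (pf_par F); lia.
  by apply: (pf_par G); lia.
(* Where the combined map differs from that of the conjunct, the latter fixes [z], so the atom has
   no variable but [z]. *)
- move=> v; rewrite map_cat mem_cat => /orP[/(pf_forest F)|/(pf_forest G)].
    move=> [z sub]; exists z => u /sub; case: ifP => // zM.
    rewrite (pf_par F) ?/pair_parent ?ifN; try lia.
    by rewrite !inE orbb => ->.
  move=> [z sub]; exists z => u /sub; case: ifP => // zM.
  rewrite (pf_par G); last by lia.
  have [zN|zN] := ltnP z N; first by rewrite (pf_par F) //; lia.
  rewrite /pair_parent ifN; last by lia.
  by rewrite !inE orbb => ->.
- move=> K db D nu /=; rewrite (pf_eval F) (pf_eval G) esum_cat.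
  (* The sum over [zs] does not depend on [ys], nor the product over [l] on [zs], so distributivity
     applies twice. *)
  rewrite -esumMr => [|z zys]; last by apply/esum_indep/indep_prod/k_ys.
  apply: eq_esum => {}nu; pose P m nu := (\prod_(a <- m) eval_atom db a nu)%R.
  transitivity (esum D zs (fun nu => P k nu * P l nu)%R nu).
    by rewrite mulrC esumMr // => z /l_zs; apply: indep_prod.
  by apply: eq_esum => {}nu; rewrite big_cat /= mulrC.
Qed.

(** Transposing [y] with the fresh [N] turns the bound [y] into [N], which hangs below [x]; fresh
    children of [y] become children of [N]. The pair [x], [y] is linked anew, as [pf_par]
    demands. *)
Lemma prenex_ex x y f N M ys l p : x != y -> x < N -> y < N -> y \in free f ->
  {subset free f <= [:: x; y]} -> prenex_form x y f N.+1 M ys l p ->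
  prenex_form x y (Ex y f) N M (N :: ys) (map (rename_atom (transp y N)) l)
    (fun z => if z == N then x else if N < z < M then transp y N (p z)
              else pair_parent x y z).
Proof.
move=> xy xN yN yf fxy F; set t := transp y N.
have NM := pf_le F.
have t_inj : injective t by apply: transp_inj.
have t_ys z : z \in ys -> t z = z.
  by move=> /(pf_ys F) zN; apply: transpD; lia.
have t_mem z : (z \in atoms_vars (map (rename_atom t) l)) = (t z \in atoms_vars l).
  by rewrite atoms_vars_rename -{1}[z](transpK y N) mem_map.
have N_l : N \notin atoms_vars l.
  apply/negP => Nl; have := pf_free F N; rewrite Nl /=.
  have [/(pf_ys F)|_] := boolP (N \in ys); first by lia.
  by move=> /fxy; rewrite !inE; lia.
have [yl y_ys] : y \in atoms_vars l /\ y \notin ys.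
  by apply/andP; rewrite -(pf_free F).
have tN : t N = y by rewrite /t /transp eqxx; case: eqVneq.
split.
- lia.
- by move=> z; rewrite inE => /orP[/eqP->|/(pf_ys F)]; lia.
- rewrite /= (pf_uniq F) andbT; apply/negP => /(pf_ys F); lia.
- by rewrite size_map (pf_nonempty F).
- rewrite all_map (eq_all (a2 := @atom_binary S)) ?(pf_binary F) // => a.
  exact: atom_binary_rename.
- move=> z; rewrite inE t_mem => /orP[/eqP->|zys]; first by rewrite tN.
  by rewrite t_ys // (pf_bound F).
- move=> z; rewrite /= mem_filter t_mem (pf_free F) inE negb_or.
  have [->|zy] := eqVneq z y; first by rewrite /t transpL (negbTE N_l).
  have [->|zN] := eqVneq z N; first by rewrite (negbTE N_l) !andbF.
  by rewrite /t transpD.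
- move=> z; case: eqVneq => [->|zN]; first exact: ltnW.
  case: ifP => zNM; last exact: pair_parent_le.
  by rewrite /t /transp; have := pf_par_le F z; do 2?case: ifP; lia.
- by move=> z zNM; rewrite !ifN //; lia.
- move=> v /=; rewrite -map_comp => vl.
  have {vl} [w wl ->] : exists2 w, w \in [seq atom_vars a | a <- l] & v = map t w.
    move: vl; elim: (l) => //= a l' IH; rewrite inE atom_vars_rename.
    move=> /orP[/eqP->|/IH[w wl' ->]]; first by exists (atom_vars a); rewrite ?mem_head.
    by exists w => //; rewrite inE wl' orbT.
  have [z sub] := pf_forest F wl.
  have subt : {subset map t w <= [:: t z; t (p z)]}.
    move=> _ /mapP[u /sub + ->]; rewrite !inE.
    by move=> /orP[]/eqP->; rewrite eqxx ?orbT.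
  (* Three kinds of edges: a fresh [z] keeps its place below the renamed parent; the edge [{x, y}]
     becomes [{x, N}] with child [N]; any other [z] is a root, and the atom has no variable but
     [t z]. *)
  have [zNM|zNM] := boolP (N < z < M).
    exists z; rewrite zNM ifN; last by lia.
    by rewrite -{1}(_ : t z = z) // /t transpD //; lia.
  have pz := pf_par F zNM.
  have [zm|zm] := eqVneq z (maxn x y).
    exists N; rewrite eqxx => u /subt; rewrite pz /pair_parent zm eqxx.
    have tx : t x = x by rewrite /t transpD //; lia.
    have ty : t y = N by rewrite /t transpL.
    rewrite !inE /maxn /minn; case: ltnP => _; rewrite tx ty //.
    by rewrite orbC.
  exists (t z) => u /subt; rewrite pz /pair_parent (negbTE zm) !inE orbb.
  by move=> ->.
- move=> K db D nu /=; apply: eq_bigr => d _.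
  pose P nu := (\prod_(a <- l) eval_atom db a nu)%R.
  (* The renaming of the atoms is moved into the valuation, where on [x] and [y] setting [N] and
     then transposing amounts to setting [y]. *)
  transitivity (esum D ys (fun nu => P (nu \o t)) (upd nu N d)); last first.
    apply: eq_esum => {}nu; rewrite big_map; apply: eq_bigr => a _.
    by rewrite eval_atom_rename.
  rewrite (esum_rename D P) // -(pf_eval F); apply: evalD_free => z zf.
  rewrite /upd /=.
  have [->|zy] := eqVneq z y; first by rewrite /t transpL eqxx.
  by have := fxy z zf; rewrite !inE (negbTE zy) orbF => /eqP->;
    rewrite /t transpD ?ifN //; lia.
Qed.

Lemma prenex_formC x y f N M ys l p :
  prenex_form x y f N M ys l p -> prenex_form y x f N M ys l p.
Proof.
by case=> *; split=> // z zN; rewrite /pair_parent maxnC minnC; auto.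
Qed.

Lemma prenex_exists x y f N : x != y -> x < N -> y < N ->
  safe f -> disjunction_free f -> formula_binary f ->
  {subset all_vars f <= [:: x; y]} ->
  exists M ys l p, prenex_form x y f N M ys l p.
Proof.
move=> xy; elim: f N => [a|z f IH|f IHf g IHg|//] N xN yN /=.
- move=> _ _ bin sub; exists N, [::], [:: a], (pair_parent x y).
  exact: prenex_atom.
- move=> [zf safef] df bin sub.
  have sub' : {subset all_vars f <= [:: x; y]}.
    by move=> u uf; apply: sub; rewrite inE uf orbT.
  have free_sub u : u \in free f -> u \in [:: x; y] by move/free_all_vars/sub'.
  have [M [ys [l [p F]]]] := IH N.+1 (ltnW xN) (ltnW yN) safef df bin sub'.
  (* [prenex_ex] binds the second variable of the pair, so the pair is swapped when [x] is
     quantified. *)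
  have := free_sub z zf; rewrite !inE => /orP[]/eqP zE; rewrite zE in zf *.
    do 4!eexists; apply: prenex_formC; apply: (prenex_ex _ yN xN zf).
    + by rewrite eq_sym.
    + by move=> u /free_sub; rewrite !inE orbC.
    + exact: prenex_formC F.
  by do 4!eexists; apply: prenex_ex F.
- move=> [safef safeg] /andP[df dg] /andP[bf bg] sub.
  have [M [ys [l [p F]]]] : exists M ys l p, prenex_form x y f N M ys l p.
    by apply: IHf => // u uf; apply: sub; rewrite mem_cat uf.
  have subg : {subset all_vars g <= [:: x; y]}.
    by move=> u ug; apply: sub; rewrite mem_cat ug orbT.
  have NM := pf_le F.
  (* The fresh names of [g] start where those of [f] end. *)
  have [L [zs [k [q G]]]] := IHg M (leq_trans xN NM) (leq_trans yN NM) safeg dg bg subg.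
  do 4!eexists; apply: prenex_and F G => //.
    by move=> u /free_all_vars uf; apply: sub; rewrite mem_cat uf.
  by move=> u /free_all_vars/subg.
Qed.

(** The prenex form is already a conjunctive query; its atoms and the head lie on edges of one
    forest, which gives both join trees. *)
Lemma FO_conj2_to_cq n (q : query S n) : FO_conj2_query q ->
  exists q' : cq S n, binary_free_connex_cq q' /\ equivalent q (cq_query q').
Proof.
case: q => h f [[/= safef hf] [/= n2 bin] [/= df /two_vars[x [y [xy sub]]]]].
pose N := (maxn x y).+1.
have [||M [ys [l [p F]]]] := @prenex_exists x y f N xy _ _ safef df bin sub.
- by rewrite /N; lia.
- by rewrite /N; lia.
case: l F => [/pf_nonempty//|a l] F; exists (CQ h ys a l).
have safe_cq : safe (foldr (@Ex S) (conj_atoms a l) ys).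
  apply/safe_foldr_Ex; first exact: safe_conj_atoms.
  by rewrite free_conj_atoms; split; [apply: pf_uniq F | apply: pf_bound F].
split; last first.
  apply: (evalD_equivalent h safef safe_cq) => K db D nu.
  rewrite evalD_foldr_Ex (pf_eval F); apply: eq_esum => {}nu.
  by rewrite evalD_conj_atoms.
split.
- split=> // z; rewrite /= free_foldr_Ex free_conj_atoms -(pf_free F).
  exact: hf.
- by split; rewrite //= binary_foldr_Ex binary_conj_atoms (pf_binary F).
- split; first exact: forest_acyclic (pf_par_le F) (pf_forest F).
  apply: forest_acyclic (pf_par_le F) _ => // v.
  rewrite inE => /orP[/eqP->|/(pf_forest F)//].
  (* The head lies on the edge [{x, y}], whose child end is the larger variable. *)
  exists (maxn x y) => z; rewrite (pf_par F); last by rewrite /N; lia.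
  by rewrite hf => /free_all_vars/sub/pair_parent_sub.
Qed.

End Prenex.

(** * Two-variable formulas from join trees *)

Section Elimination.
Variable S : vocab.
Implicit Types (f g : formula S) (s : var -> var).

Lemma all_vars_rename s f : all_vars (rename s f) = map s (all_vars f).
Proof.
elim: f => /= [a|y f ->|f -> g ->|f -> g ->] //; rewrite ?map_cat //.
exact: atom_vars_rename.
Qed.

(** Injectivity on all variables, bound ones included, rules out capture. *)
Lemma free_rename s f : {in all_vars f &, injective s} ->
  free (rename s f) = map s (free f).
Proof.
elim: f => /= [a _|y f IH s_inj|f IHf g IHg s_inj|f IHf g IHg s_inj].
- exact: atom_vars_rename.
- rewrite IH => [|u v uf vf]; last by apply: s_inj; rewrite inE ?uf ?vf orbT.
  rewrite filter_map; congr map; apply: eq_in_filter => z /free_all_vars zf /=.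
  by rewrite (inj_in_eq s_inj) // inE ?eqxx ?zf ?orbT.
- rewrite map_cat IHf ?IHg // => u v uf vf; apply: s_inj;
    by rewrite mem_cat ?uf ?vf ?orbT.
- rewrite map_cat IHf ?IHg // => u v uf vf; apply: s_inj;
    by rewrite mem_cat ?uf ?vf ?orbT.
Qed.

Lemma evalD_rename (K : comNzSemiRingType) (db : database S K) D s f nu :
  {in all_vars f &, injective s} ->
  evalD db D (rename s f) nu = evalD db D f (nu \o s).
Proof.
elim: f nu => /= [a|y f IH|f IHf g IHg|f IHf g IHg] nu s_inj.
- exact: eval_atom_rename.
- apply: eq_bigr => d _; rewrite IH => [|u v uf vf]; last first.
    by apply: s_inj; rewrite inE ?uf ?vf orbT.
  apply: evalD_free => z /free_all_vars zf; rewrite /upd /=.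
  by rewrite (inj_in_eq s_inj) // inE ?eqxx ?zf ?orbT.
- rewrite IHf ?IHg // => u v uf vf; apply: s_inj;
    by rewrite mem_cat ?uf ?vf ?orbT.
- rewrite IHf ?IHg // => u v uf vf; apply: s_inj;
    by rewrite mem_cat ?uf ?vf ?orbT.
Qed.

Lemma safe_rename s f : {in all_vars f &, injective s} ->
  safe f -> safe (rename s f).
Proof.
elim: f => //= [y f IH|f IHf g IHg|f IHf g IHg] s_inj.
- have s_inj' : {in all_vars f &, injective s}.
    by move=> u v uf vf; apply: s_inj; rewrite inE ?uf ?vf orbT.
  by rewrite free_rename // => -[yf /IH]; split; [apply: map_f | auto].
- have s_injf : {in all_vars f &, injective s}.
    by move=> u v uf vf; apply: s_inj; rewrite mem_cat ?uf ?vf.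
  have s_injg : {in all_vars g &, injective s}.
    by move=> u v uf vf; apply: s_inj; rewrite mem_cat ?uf ?vf orbT.
  by move=> [/IHf + /IHg]; auto.
- have s_injf : {in all_vars f &, injective s}.
    by move=> u v uf vf; apply: s_inj; rewrite mem_cat ?uf ?vf.
  have s_injg : {in all_vars g &, injective s}.
    by move=> u v uf vf; apply: s_inj; rewrite mem_cat ?uf ?vf orbT.
  move=> [fg /IHf + /IHg]; rewrite !free_rename //; split; auto.
  exact: eq_mem_map.
Qed.

Lemma disjunction_free_rename s f :
  disjunction_free (rename s f) = disjunction_free f.
Proof. by elim: f => //= f -> g ->. Qed.

Lemma binary_rename s f : formula_binary (rename s f) = formula_binary f.
Proof.
by elim: f => //= [a|f -> g ->|f -> g ->] //; apply: atom_binary_rename.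
Qed.

Record two_var (c d : var) f : Prop := TwoVar {
  tv_neq : c != d;
  tv_safe : safe f;
  tv_conj : disjunction_free f;
  tv_binary : formula_binary f;
  tv_vars : {subset all_vars f <= [:: c; d]} }.

Lemma two_var_size c d f : two_var c d f -> size (undup (all_vars f)) <= 2.
Proof.
move=> /tv_vars sub; apply: (@uniq_leq_size _ _ [:: c; d]).
  exact: undup_uniq.
by move=> z; rewrite mem_undup => /sub.
Qed.

Lemma two_var_and c d f g :
  two_var c d f -> two_var c d g -> two_var c d (And f g).
Proof.
move=> F G; split=> /=.
- exact: tv_neq F.
- by split; [apply: tv_safe F | apply: tv_safe G].
- by rewrite (tv_conj F) (tv_conj G).
- by rewrite (tv_binary F) (tv_binary G).
- by move=> z; rewrite mem_cat => /orP[/(tv_vars F)|/(tv_vars G)].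
Qed.

Lemma two_var_ex c d f ys : two_var c d f -> uniq ys ->
  {subset ys <= free f} -> two_var c d (foldr (@Ex S) f ys).
Proof.
move=> F uys sub; split.
- exact: tv_neq F.
- by apply/safe_foldr_Ex; first exact: tv_safe F.
- by rewrite disjunction_free_foldr_Ex (tv_conj F).
- by rewrite binary_foldr_Ex (tv_binary F).
- move=> z; rewrite all_vars_foldr_Ex mem_cat.
  by move=> /orP[/sub/free_all_vars|]; apply: (tv_vars F).
Qed.

(* Only the bound occurrences need new names, since [c] and [d] already contain
   the free variables. *)
Lemma two_var_retarget a b c d f : two_var a b f -> c != d ->
  {subset free f <= [:: c; d]} ->
  exists g, [/\ two_var c d g, free g =i free f & evalD_equiv g f].
Proof.
move=> F cd sub; have ab := tv_neq F.
(* Free variables keep their names, and a variable that is not free takes a name left over from [c]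
   and [d]. *)
have [a' [b' [a'b' a'cd b'cd aE bE]]] : exists a' b' : var,
    [/\ a' != b', a' \in [:: c; d], b' \in [:: c; d],
        a \in free f -> a' = a & b \in free f -> b' = b].
  pose other z := if z == c then d else c.
  have other_in z : other z \in [:: c; d].
    by rewrite /other !inE; case: ifP; rewrite eqxx ?orbT.
  have other_neq z : z != other z.
    rewrite /other; case: (eqVneq z c) => // ->; exact: cd.
  have otherE z u : z \in [:: c; d] -> u \in [:: c; d] -> z != u -> other z = u.
    rewrite !inE /other => /orP[]/eqP-> /orP[]/eqP->; rewrite ?eqxx //.
    by rewrite eq_sym (negbTE cd).
  have [af|af] := boolP (a \in free f).
    exists a, (other a); split=> //; first exact: sub.
    by move=> bf; apply: otherE => //; apply: sub.
  have [bf|bf] := boolP (b \in free f).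
    exists (other b), b; split=> //; first by rewrite eq_sym.
    exact: sub.
  by exists c, d; split; rewrite // !inE eqxx ?orbT.
pose s z := if z == a then a' else b'.
have s_inj : {in all_vars f &, injective s}.
  move=> u v /(tv_vars F) + /(tv_vars F); rewrite !inE.
  move=> /orP[]/eqP-> /orP[]/eqP->; rewrite /s ?eqxx // (eq_sym b a) (negbTE ab).
    by move=> E; rewrite E eqxx in a'b'.
  by move=> E; rewrite E eqxx in a'b'.
have sE z : z \in free f -> s z = z.
  move=> zf; have := tv_vars F (free_all_vars zf).
  rewrite !inE /s => /orP[]/eqP zE; rewrite zE in zf *.
    by rewrite eqxx aE.
  by rewrite eq_sym (negbTE ab) bE.
exists (rename s f); split.
- split=> //.
  + exact/safe_rename/(tv_safe F).
  + by rewrite disjunction_free_rename (tv_conj F).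
  + by rewrite binary_rename (tv_binary F).
  + by move=> z; rewrite all_vars_rename => /mapP[u _ ->]; rewrite /s; case: ifP.
- by rewrite free_rename // (map_id_in sE).
- move=> K db D nu; rewrite evalD_rename //.
  by apply: evalD_free => z zf /=; rewrite sE.
Qed.

(** Elimination replaces atoms by formulas. The sequence [node_vars] is stored apart from [free],
    which it matches as a set, so that conjoining a formula leaves [rip] literally unchanged. *)
Record node := Node {
  node_vars : seq var;
  node_formula : formula S;
  node_free : free node_formula =i node_vars;
  node_two_var : exists c d, two_var c d node_formula }.

Definition nodes_vars (ts : seq node) : seq var := flatten (map node_vars ts).

Lemma nodes_varsP ts z :
  reflect (exists2 u, u \in map node_vars ts & z \in u) (z \in nodes_vars ts).
Proof. exact: flattenP. Qed.

Lemma mem_map_split (T : Type) (U : eqType) (F : T -> U) (l : seq T) u :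
  u \in map F l -> exists l1 x l2, l = l1 ++ x :: l2 /\ u = F x.
Proof.
elim: l => //= x l IH; rewrite inE => /orP[/eqP->|/IH[l1 [y [l2 [-> ->]]]]].
  by exists [::], x, l.
by exists (x :: l1), y, l2.
Qed.

(* A leaf of the join tree shares variables with the rest only through its
   parent, so its private variables can be quantified locally; the resulting
   formula is then conjoined to the parent. *)
Lemma eliminate c d (h : seq var) (ts : seq node) ys :
  c != d -> {subset h <= [:: c; d]} -> 0 < size ts ->
  rip (map node_vars ts) h -> uniq ys ->
  (forall z, (z \in ys) = (z \in nodes_vars ts) && (z \notin h)) ->
  exists g, [/\ two_var c d g,
    forall z, (z \in free g) = (z \in nodes_vars ts) && (z \in h) &
    forall (K : comNzSemiRingType) (db : database S K) D nu,
      esum D ys (fun nu => \prod_(t <- ts) evalD db D (node_formula t) nu)%R nu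
      = evalD db D g nu].
Proof.
move=> cd hcd; have [n] := ubnP (size ts); elim: n => // n IH in ts ys *.
case: ts => // t ts; rewrite ltnS => szn _ /= [[w wts wP] rip_ts] uys ysE.
have wts' z : z \in w -> (z \in nodes_vars ts) || (z \in h).
  move: wts; rewrite mem_rcons inE => /orP[/eqP-> ->|wts zw]; first by rewrite orbT.
  by apply/orP; left; apply/nodes_varsP; exists w.
have t_ts z : z \in node_vars t -> z \in nodes_vars ts -> z \in w.
  move=> zt /nodes_varsP[u uts]; apply: wP zt.
  by rewrite mem_rcons inE uts orbT.
have t_h z : z \in node_vars t -> z \in h -> z \in w.
  by apply: wP; rewrite mem_rcons mem_head.
have vars_cons z :
    (z \in nodes_vars (t :: ts)) = (z \in node_vars t) || (z \in nodes_vars ts).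
  by rewrite /nodes_vars /= mem_cat.
pose priv z := (z \in node_vars t) && (z \notin w).
pose zs := [seq y <- ys | priv y]; pose ys' := [seq y <- ys | ~~ priv y].
pose e := foldr (@Ex S) (node_formula t) zs.
have uys' : uniq ys' by rewrite filter_uniq.
(* A variable of the leaf that is not private lies in [w], hence in the remaining nodes or in the
   head. *)
have ys'E z : (z \in ys') = (z \in nodes_vars ts) && (z \notin h).
  rewrite mem_filter ysE vars_cons /priv negb_and negbK.
  have := t_ts z; have := wts' z.
  case: (z \in node_vars t); case: (z \in w); case: (z \in nodes_vars ts);
    case: (z \in h) => //= H1 H2;
    by [have := H1 isT | have := H2 isT isT].
have freee z : (z \in free e) = (z \in node_vars t) && (z \in w).
  rewrite free_foldr_Ex node_free mem_filter ysE vars_cons /priv.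
  have := t_h z.
  case: (z \in node_vars t) => //=; case: (z \in w) => //=.
  by case: (z \in h) => // /(_ isT isT).
have [a [b tvt]] := node_two_var t.
have tve : two_var a b e.
  apply: two_var_ex tvt _ _; first by rewrite filter_uniq.
  by move=> z; rewrite mem_filter node_free => /andP[/andP[]].
have sumE (K : comNzSemiRingType) (db : database S K) D nu :
    esum D ys (fun nu => \prod_(u <- t :: ts) evalD db D (node_formula u) nu)%R nu
    = esum D ys' (fun nu => evalD db D e nu *
        \prod_(u <- ts) evalD db D (node_formula u) nu)%R nu.
  rewrite (esum_filter D priv) //; apply: eq_esum => {}nu.
  pose P nu := (\prod_(u <- ts) evalD db D (node_formula u) nu)%R.
  transitivity (esum D zs (fun nu => evalD db D (node_formula t) nu * P nu)%R nu).
    by apply: eq_esum => {}nu; rewrite big_cons.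
  rewrite esumMr ?evalD_foldr_Ex // => z; rewrite mem_filter => /andP[/andP[zt zw] _].
  move=> {}nu d'; rewrite /P.
  have : z \notin nodes_vars ts by apply: contra zw; apply: t_ts.
  elim: (ts) => [|u us IHus]; first by rewrite !big_nil.
  rewrite /nodes_vars /= mem_cat negb_or => /andP[zu zus].
  by rewrite !big_cons IHus // evalD_indep // node_free.
(* If the parent is the head, the free variables of [e] are head variables, so [e] is a factor
   outside the sum over [ys']. *)
move: wts; rewrite mem_rcons inE => /orP[/eqP wh|].
  have [|e' [tve' freee' e'E]] := two_var_retarget tve cd.
    by move=> z; rewrite freee wh => /andP[_ /hcd].
  have ys'e : {in ys', forall z, z \notin free e}.
    by move=> z; rewrite ys'E freee wh => /andP[_ /negbTE->]; rewrite andbF.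
  (* The last leaf ends the recursion: no node is left to supply a second conjunct. *)
  have [ts0|ts_gt0] := posnP (size ts).
    exists e'; split=> // [z|K db D nu].
      by rewrite freee' freee vars_cons (size0nil ts0) /nodes_vars orbF wh.
    rewrite sumE e'E; have -> : ys' = [::].
      case E: ys' => [|y r] //; have := ys'E y.
      by rewrite E mem_head (size0nil ts0).
    by rewrite /= (size0nil ts0) big_nil mulr1.
  have [g [tvg freeg gE]] := IH ts ys' szn ts_gt0 rip_ts uys' ys'E.
  exists (And e' g); split=> [|z|K db D nu]; first exact: two_var_and.
    by rewrite /= mem_cat freee' freee freeg vars_cons wh andb_orl.
  rewrite sumE /= e'E -gE mulrC.
  rewrite -[RHS]esumMr; last by move=> z /ys'e; apply: evalD_indep.
  by apply: eq_esum => {}nu; rewrite mulrC.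
(* Otherwise the parent is a node [t']. Conjoining [e'], written over the two names of [t'], changes
   the variables of no node, so the running intersection persists. *)
case/mem_map_split=> ts1 [t' [ts2 [tsE wE]]].
have [a' [b' tvt']] := node_two_var t'.
have [||e' [tve' freee' e'E]] := two_var_retarget tve (c := a') (d := b').
- exact: tv_neq tvt'.
- move=> z; rewrite freee wE -(node_free t') => /andP[_ /free_all_vars].
  exact: tv_vars tvt' z.
have free_new : free (And (node_formula t') e') =i node_vars t'.
  move=> z; rewrite /= mem_cat node_free freee' freee -wE.
  by case: (z \in w); rewrite ?andbF.
pose t'' := Node free_new
  (ex_intro _ a' (ex_intro _ b' (two_var_and tvt' tve'))).
pose ts' := ts1 ++ t'' :: ts2.
have varsE : map node_vars ts' = map node_vars ts.
  by rewrite /ts' tsE !map_cat.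
have nvarsE : nodes_vars ts' = nodes_vars ts by rewrite /nodes_vars varsE.
have [||||g [tvg freeg gE]] := IH ts' ys' _ _ _ uys'.
- by rewrite -(size_map node_vars) varsE size_map.
- by rewrite -(size_map node_vars) varsE size_map tsE size_cat addnS.
- by rewrite varsE.
- by move=> z; rewrite nvarsE.
exists g; split=> // [z|K db D nu].
  rewrite freeg nvarsE vars_cons; have := t_h z.
  have : z \in w -> z \in nodes_vars ts.
    move=> zw; apply/nodes_varsP; exists w => //.
    by rewrite tsE map_cat mem_cat /= wE mem_head orbT.
  case: (z \in h); rewrite ?andbF ?andbT // => H1 H2.
  by case: (z \in node_vars t) H2 => //= /(_ isT isT)/H1.
rewrite sumE -gE; apply: eq_esum => {}nu.
rewrite tsE /ts' !big_cat !big_cons /= e'E.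
by rewrite mulrCA; congr (_ * _)%R; rewrite mulrA; congr (_ * _)%R; rewrite mulrC.
Qed.

Lemma atom_nodes (l : seq (atom S)) : all (@atom_binary S) l ->
  exists ts, map node_vars ts = map (@atom_vars S) l /\
    map node_formula ts = map (@Atom S) l.
Proof.
elim: l => [_|a l IH /= /andP[bin /IH[ts [varsE formE]]]]; first by exists [::].
have [x [y [xy sub]]] : exists x y, x != y /\ {subset atom_vars a <= [:: x; y]}.
  apply: two_vars; apply: leq_trans (size_undup _) _.
  by case: (a) bin => //= R xs; rewrite size_tuple.
have tv : two_var x y (Atom a) by split.
have fr : free (Atom a) =i atom_vars a by [].
exists (Node fr (ex_intro _ x (ex_intro _ y tv)) :: ts).
by rewrite /= varsE formE.
Qed.

(** Acyclicity with the head as a node orders the body atoms from the leaves to the root [h];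
    eliminating them in that order leaves a formula over two names that cover the head. *)
Lemma cq_to_FO_conj2 n (q : cq S n) : binary_free_connex_cq q ->
  exists q' : query S n, FO_conj2_query q' /\ equivalent (cq_query q) q'.
Proof.
case: q => h ys a l [[/= safeq hq] [/= n2 bin] [_ /acyclic_rip]].
rewrite -/(conj_atoms a l) in safeq hq bin.
rewrite /cq_atom_vars [cq_atom1 _]/= [cq_atoms _]/= => -[s []].
set vs := map _ _; rewrite size_map => perm_s rip_s.
rewrite binary_foldr_Ex binary_conj_atoms in bin.
have [uys ys_sub] : uniq ys /\ {subset ys <= atoms_vars (a :: l)}.
  by rewrite -free_conj_atoms; apply/safe_foldr_Ex => //; apply: safe_conj_atoms.
pose at_ i := nth a (a :: l) i.
have s_lt i : i \in s -> i < size (a :: l).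
  by rewrite (perm_mem perm_s) mem_iota add0n => /andP[].
have [|ts [ts_vars ts_form]] := @atom_nodes (map at_ s).
  by rewrite all_map; apply/allP => i /s_lt; apply/all_nthP.
have {}ts_vars : map node_vars ts = [seq nth [::] vs i | i <- s].
  rewrite ts_vars -map_comp; apply/eq_in_map => i /s_lt il.
  by rewrite /= (nth_map a).
have ts_all : nodes_vars ts =i atoms_vars (a :: l).
  move=> z; rewrite /nodes_vars ts_vars; apply/perm_mem/perm_flatten.
  rewrite (perm_trans (perm_map _ perm_s)) // -(size_map (@atom_vars S)).
  by rewrite -/vs -[X in perm_eq _ X](mkseq_nth [::]).
have hE z : (z \in h) = (z \in atoms_vars (a :: l)) && (z \notin ys).
  by rewrite hq free_foldr_Ex free_conj_atoms.
have [c [d [cd hcd]]] : exists c d, c != d /\ {subset h <= [:: c; d]}.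
  by apply/two_vars/(leq_trans (size_undup _)); rewrite size_tuple.
have [||||g [tvg freeg gE]] := @eliminate c d h ts ys cd hcd.
- by rewrite -(size_map node_vars) ts_vars size_map (perm_size perm_s) size_iota.
- by rewrite ts_vars.
- by [].
- move=> z; rewrite ts_all hE; have := ys_sub z.
  by case: (z \in ys) => [->//|_]; rewrite andbT andbN.
have free_g : h =i free g.
  by move=> z; rewrite freeg ts_all hE; case: (z \in atoms_vars _).
exists (Query h g); split.
  split; split=> //=; [exact: tv_safe tvg|exact: tv_binary tvg|
    exact: tv_conj tvg|exact: two_var_size tvg].
apply: evalD_equivalent (tv_safe tvg) _ => // K db D nu.
rewrite evalD_foldr_Ex -gE; apply: eq_esum => {}nu.
rewrite evalD_conj_atoms.
(* The nodes list the body atoms in the order [s], a permutation, which commutativity of the product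
   undoes. *)
transitivity (\prod_(f <- map node_formula ts) evalD db D f nu)%R; last by rewrite big_map.
rewrite ts_form -map_comp big_map (perm_big _ perm_s) (big_nth a) /=.
by rewrite /index_iota subn0.
Qed.

End Elimination.

Theorem theorem6 (S : vocab) (n : nat) :
  (forall q : cq S n, binary_free_connex_cq q ->
     exists q' : query S n, FO_conj2_query q' /\ equivalent (cq_query q) q') /\
  (forall q : query S n, FO_conj2_query q ->
     exists q' : cq S n, binary_free_connex_cq q' /\ equivalent q (cq_query q')).
Proof. by split=> q; [apply: cq_to_FO_conj2 | apply: FO_conj2_to_cq]. Qed.
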